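(* Let $G_1=(V_1,E_1,\mu_1,\zeta_1)$ and $G_2=(V_2,E_2,\mu_2,\zeta_2)$ be two finite attributed graphs, and let $c$ be a real-valued edit cost function assigning costs $c(u_i\to v_k)$, $c(u_i\to\epsilon)$, $c(\epsilon\to v_k)$ to vertex substitutions, deletions and insertions, and $c(e_{ij}\to e_{kl})$, $c(e_{ij}\to\epsilon)$, $c(\epsilon\to e_{kl})$ to edge substitutions, deletions and insertions, for $u_i\in V_1$, $v_k\in V_2$, $e_{ij}\in E_1$, $e_{kl}\in E_2$. Define the similarity function $s'$ by $$s'(u_i\to v_k)=-\bigl(c(u_i\to v_k)-c(u_i\to\epsilon)-c(\epsilon\to v_k)\bigr),$$ $$s'(e_{ij}\to e_{kl})=-\bigl(c(e_{ij}\to e_{kl})-c(e_{ij}\to\epsilon)-c(\epsilon\to e_{kl})\bigr).$$ Then the graph matching problem for $(G_1,G_2)$ with similarity function $s'$ and the graph edit distance problem for $(G_1,G_2)$ with cost function $c$ are equivalent in terms of solutions: an assignment vector $y$ is an optimal solution of the graph matching problem with similarity $s'$ if and only if the edit path $\lambda(y)$ induced by $y$ is a minimum-cost edit path, i.e. an optimal solution of the graph edit distance problem with cost $c$.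
   Context: **Attributed graphs.** An attributed graph is $G=(V,E,\mu,\zeta)$ with $V$ a finite set of vertices, $E\subseteq V\times V$ a set of edges, $\mu$ a vertex labeling function and $\zeta$ an edge labeling function. Labels matter only through the values of the cost and similarity functions, which may be arbitrary real numbers. Write $e_{ij}=(u_i,u_j)\in E_1$ and $e_{kl}=(v_k,v_l)\in E_2$. **Assignment vectors.** An assignment vector is $y=(y_{i,k})\in\{0,1\}^{V_1\times V_2}$ with $\sum_{u_i\in V_1}y_{i,k}\le 1$ for all $v_k\in V_2$ and $\sum_{v_k\in V_2}y_{i,k}\le 1$ for all $u_i\in V_1$. Here $y_{i,k}=1$ means that $u_i$ is matched to $v_k$. **Graph matching (GM) problem.** Given a real-valued similarity function $s$ on vertex pairs $V_1\times V_2$ and on edge pairs $E_1\times E_2$, maximize over all assignment vectors $y$ $$S(G_1,G_2,y)=\sum_{u_i\in V_1}\sum_{v_k\in V_2}s(u_i\to v_k)\,y_{i,k}+\sum_{e_{ij}\in E_1}\sum_{e_{kl}\in E_2}s(e_{ij}\to e_{kl})\,y_{i,k}\,y_{j,l}.$$ **Graph edit distance (GED) problem.** Edit operations are: vertex substitution $(u_i\to v_k)$, vertex deletion $(u_i\to\epsilon)$, vertex insertion $(\epsilon\to v_k)$, edge substitution $(e_{ij}\to e_{kl})$, edge deletion $(e_{ij}\to\epsilon)$ and edge insertion $(\epsilon\to e_{kl})$. An edit path is a finite set $\lambda$ of edit operations transforming $G_1$ completely into $G_2$, subject to the following constraints. Each vertex or edge has at most one edit operation applied to it (together with completeness, each vertex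 and edge of $G_1$ is either substituted or deleted, and each vertex and edge of $G_2$ is either the target of a substitution or inserted). Deleting a vertex implies deleting all its incident edges. An edge may be inserted only between vertices that already exist or have been inserted, and never creates more than one edge between two vertices. Topological constraint: substituting $(u_i,u_j)\in E_1$ by $(v_k,v_l)\in E_2$ is valid if and only if $u_i\to v_k$ and $u_j\to v_l$ are performed. Edge operations are driven by the vertex matching. Whenever $u_i\to v_k$ and $u_j\to v_l$ are performed: if $(u_i,u_j)\in E_1$ and $(v_k,v_l)\in E_2$, then the edge substitution $e_{ij}\to e_{kl}$ is performed; if $(u_i,u_j)\in E_1$ and $(v_k,v_l)\notin E_2$, then $e_{ij}$ is deleted; if $(u_i,u_j)\notin E_1$ and $(v_k,v_l)\in E_2$, then $e_{kl}$ is inserted. Hence the edit paths are exactly the sets $\lambda(y)$, for $y$ an assignment vector, defined as follows: - $\lambda(y)$ contains $(u_i\to v_k)$ for each $y_{i,k}=1$; - $(u_i\to\epsilon)$ for each $u_i$ with $\sum_k y_{i,k}=0$; - $(\epsilon\to v_k)$ for each $v_k$ with $\sum_i y_{i,k}=0$; - $(e_{ij}\to e_{kl})$ for each $e_{ij}\in E_1$, $e_{kl}\in E_2$ with $y_{i,k}=y_{j,l}=1$; - $(e_{ij}\to\epsilon)$ for every $e_{ij}\in E_1$ not so substituted; - $(\epsilon\to e_{kl})$ for every $e_{kl}\in E_2$ not so substituted. Let $\Gamma(G_1,G_2)$ be the set of all edit paths. The GED problem is to find $\lambda\in\Gamma(G_1,G_2)$ attaining $$d_{\min}(G_1,G_2)=\min_{\lambda\in\Gamma(G_1,G_2)}\sum_{o\in\lambda}c(o).$$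 *)

(* Defs.v *)
From HB Require Import structures.
From mathcomp Require Import all_boot all_order all_algebra.
From mathcomp Require Import reals.

Set Implicit Arguments.
Unset Strict Implicit.
Unset Printing Implicit Defensive.

Import Order.TTheory GRing.Theory Num.Theory.
Local Open Scope ring_scope.

(* Edges are ordered pairs, and loops are allowed. An undirected graph is
   represented by a symmetric edge set. *)
Record attributed_graph := AttributedGraph {
  vertex : finType;
  edge_set : {set vertex * vertex};
  vlabel : Type;
  elabel : Type;
  vlabeling : vertex -> vlabel;
  elabeling : {e : vertex * vertex | e \in edge_set} -> elabel
}.

Definition edge (G : attributed_graph) : finType :=
  {e : vertex G * vertex G | e \in edge_set G}.

Definition etail (G : attributed_graph) (e : edge G) : vertex G := (val e).1.
Definition ehead (G : attributed_graph) (e : edge G) : vertex G := (val e).2.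

Definition is_assignment (G1 G2 : attributed_graph)
    (y : {ffun vertex G1 * vertex G2 -> bool}) : Prop :=
  (forall k : vertex G2, (\sum_(i : vertex G1) y (i, k) <= 1)%N) /\
  (forall i : vertex G1, (\sum_(k : vertex G2) y (i, k) <= 1)%N).

Record similarity (R : realType) (G1 G2 : attributed_graph) := Similarity {
  vsim : vertex G1 -> vertex G2 -> R;
  esim : edge G1 -> edge G2 -> R
}.

Definition gm_score (R : realType) (G1 G2 : attributed_graph)
    (s : similarity R G1 G2) (y : {ffun vertex G1 * vertex G2 -> bool}) : R :=
  \sum_(i : vertex G1) \sum_(k : vertex G2) vsim s i k * (y (i, k))%:R
  + \sum_(e1 : edge G1) \sum_(e2 : edge G2)
      esim s e1 e2 * (y (etail e1, etail e2))%:R * (y (ehead e1, ehead e2))%:R.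

Definition gm_optimal (R : realType) (G1 G2 : attributed_graph)
    (s : similarity R G1 G2) (y : {ffun vertex G1 * vertex G2 -> bool}) :
    Prop :=
  is_assignment y /\
  forall z : {ffun vertex G1 * vertex G2 -> bool},
    is_assignment z -> gm_score s z <= gm_score s y.

Inductive edit_op (G1 G2 : attributed_graph) : Type :=
| VSubst of vertex G1 & vertex G2
| VDel of vertex G1
| VIns of vertex G2
| ESubst of edge G1 & edge G2
| EDel of edge G1
| EIns of edge G2.

Arguments VSubst {G1 G2} _ _.
Arguments VDel {G1 G2} _.
Arguments VIns {G1 G2} _.
Arguments ESubst {G1 G2} _ _.
Arguments EDel {G1 G2} _.
Arguments EIns {G1 G2} _.

Section EditOpFinite.
Variables G1 G2 : attributed_graph.

Definition edit_op_code (o : edit_op G1 G2) :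
    (vertex G1 * vertex G2 + vertex G1 + vertex G2)
    + (edge G1 * edge G2 + edge G1 + edge G2) :=
  match o with
  | VSubst u v => inl (inl (inl (u, v)))
  | VDel u => inl (inl (inr u))
  | VIns v => inl (inr v)
  | ESubst e1 e2 => inr (inl (inl (e1, e2)))
  | EDel e1 => inr (inl (inr e1))
  | EIns e2 => inr (inr e2)
  end.

Definition edit_op_decode
    (x : (vertex G1 * vertex G2 + vertex G1 + vertex G2)
         + (edge G1 * edge G2 + edge G1 + edge G2)) : edit_op G1 G2 :=
  match x with
  | inl (inl (inl (u, v))) => VSubst u v
  | inl (inl (inr u)) => VDel u
  | inl (inr v) => VIns v
  | inr (inl (inl (e1, e2))) => ESubst e1 e2
  | inr (inl (inr e1)) => EDel e1
  | inr (inr e2) => EIns e2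
  end.

Lemma edit_op_codeK : cancel edit_op_code edit_op_decode.
Proof. by case. Qed.

HB.instance Definition _ := Finite.copy (edit_op G1 G2) (can_type edit_op_codeK).

End EditOpFinite.

Definition on_src_vertex (G1 G2 : attributed_graph) (u : vertex G1)
    (o : edit_op G1 G2) : bool :=
  match o with VSubst u' _ | VDel u' => u' == u | _ => false end.

Definition on_tgt_vertex (G1 G2 : attributed_graph) (v : vertex G2)
    (o : edit_op G1 G2) : bool :=
  match o with VSubst _ v' | VIns v' => v' == v | _ => false end.

Definition on_src_edge (G1 G2 : attributed_graph) (e : edge G1)
    (o : edit_op G1 G2) : bool :=
  match o with ESubst e' _ | EDel e' => e' == e | _ => false end.

Definition on_tgt_edge (G1 G2 : attributed_graph) (e : edge G2)
    (o : edit_op G1 G2) : bool :=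
  match o with ESubst _ e' | EIns e' => e' == e | _ => false end.

(* The cardinality conditions combine "at most one operation per vertex and
   edge" with completeness of the transformation; [ep_tgt_edge] also prevents
   the creation of parallel edges. *)
Record is_edit_path (G1 G2 : attributed_graph)
    (lam : {set edit_op G1 G2}) : Prop := IsEditPath {
  ep_src_vertex : forall u : vertex G1,
    #|[set o in lam | on_src_vertex u o]| = 1%N;
  ep_tgt_vertex : forall v : vertex G2,
    #|[set o in lam | on_tgt_vertex v o]| = 1%N;
  ep_src_edge : forall e1 : edge G1,
    #|[set o in lam | on_src_edge e1 o]| = 1%N;
  ep_tgt_edge : forall e2 : edge G2,
    #|[set o in lam | on_tgt_edge e2 o]| = 1%N;
  ep_vertex_deletion : forall (u : vertex G1) (e1 : edge G1),
    VDel u \in lam -> etail e1 = u \/ ehead e1 = u -> EDel e1 \in lam;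
  ep_insertion_endpoints : forall (v : vertex G2) (e2 : edge G2),
    EIns e2 \in lam -> etail e2 = v \/ ehead e2 = v ->
    (exists u : vertex G1, VSubst u v \in lam) \/ VIns v \in lam;
  (* The topological constraint is the left-to-right direction; the converse
     is the first of the rules making vertex matches drive edge operations. *)
  ep_edge_substitution : forall (e1 : edge G1) (e2 : edge G2),
    ESubst e1 e2 \in lam <->
    VSubst (etail e1) (etail e2) \in lam /\ VSubst (ehead e1) (ehead e2) \in lam;
  ep_edge_deletion : forall (e1 : edge G1) (k l : vertex G2),
    VSubst (etail e1) k \in lam -> VSubst (ehead e1) l \in lam ->
    (k, l) \notin edge_set G2 -> EDel e1 \in lam;
  ep_edge_insertion : forall (i j : vertex G1) (e2 : edge G2),
    VSubst i (etail e2) \in lam -> VSubst j (ehead e2) \in lam ->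
    (i, j) \notin edge_set G1 -> EIns e2 \in lam
}.

Definition induced_edit_path (G1 G2 : attributed_graph)
    (y : {ffun vertex G1 * vertex G2 -> bool}) : {set edit_op G1 G2} :=
  let substituted (e1 : edge G1) (e2 : edge G2) :=
    y (etail e1, etail e2) && y (ehead e1, ehead e2) in
  [set o : edit_op G1 G2 |
    match o with
    | VSubst i k => y (i, k)
    | VDel i => (\sum_(k : vertex G2) y (i, k))%N == 0%N
    | VIns k => (\sum_(i : vertex G1) y (i, k))%N == 0%N
    | ESubst e1 e2 => substituted e1 e2
    | EDel e1 => ~~ [exists e2 : edge G2, substituted e1 e2]
    | EIns e2 => ~~ [exists e1 : edge G1, substituted e1 e2]
    end].

Definition edit_cost (R : realType) (G1 G2 : attributed_graph)
    (c : edit_op G1 G2 -> R) (lam : {set edit_op G1 G2}) : R :=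
  \sum_(o in lam) c o.

Definition ged_optimal (R : realType) (G1 G2 : attributed_graph)
    (c : edit_op G1 G2 -> R) (lam : {set edit_op G1 G2}) : Prop :=
  is_edit_path lam /\
  forall lam' : {set edit_op G1 G2},
    is_edit_path lam' -> edit_cost c lam <= edit_cost c lam'.

Definition similarity_of_cost (R : realType) (G1 G2 : attributed_graph)
    (c : edit_op G1 G2 -> R) : similarity R G1 G2 :=
  {| vsim := fun i k => - (c (VSubst i k) - c (VDel i) - c (VIns k));
     esim := fun e1 e2 => - (c (ESubst e1 e2) - c (EDel e1) - c (EIns e2)) |}.

(* Main.v *)
(** For an edit path [lam], let [x o] be the indicator of [o \in lam]. "Exactly
    one operation per vertex and edge" says that
    [x (VDel u) = 1 - \sum_k x (VSubst u k)], and similarly for insertions and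
    for edges. Eliminating deletions and insertions from the cost turns it into
    the cost of deleting all of G1 and inserting all of G2, minus the score of
    the matching [x (VSubst _ _)]. The two objectives thus differ by a sign and
    an additive constant. *)

Require Import Defs.
From mathcomp Require Import all_boot all_order all_algebra.
From mathcomp Require Import reals ring.

Set Implicit Arguments.
Unset Strict Implicit.
Unset Printing Implicit Defensive.

Import Order.TTheory GRing.Theory Num.Theory.
Local Open Scope ring_scope.

(** Turns the row and column constraints of an assignment into partial injectivity. *)
Lemma sum_pred_le1P (T : finType) (P : pred T) :
  reflect (forall x z, P x -> P z -> x = z) (\sum_x P x <= 1)%N.
Proof.
have -> : (\sum_x P x = #|P|)%N.
  rewrite -sum1_card [RHS]big_mkcond; apply: eq_bigr => x _.
  by rewrite unfold_in; case: (P x).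
apply: (iffP card_le1_eqP) => H x z; first by move=> Px Pz; apply: (H z x).
by move=> Px Pz; apply: H.
Qed.

Lemma sum_pred_eq0 (T : finType) (P : pred T) :
  (\sum_x P x == 0)%N = ~~ [exists x, P x].
Proof.
rewrite sum_nat_eq0 negb_exists; apply: eq_forallb => x.
by case: (P x).
Qed.

(** The first summand is the test by which [induced_edit_path] decides a deletion or an
    insertion. *)
Lemma exactly_one (T : finType) (P : pred T) :
  (\sum_x P x <= 1)%N -> ((\sum_x P x == 0) + \sum_x P x = 1)%N.
Proof. by case: (\sum_x P x)%N => [|[]]. Qed.

Section EditPaths.
Variables G1 G2 : attributed_graph.
Local Notation op := (edit_op G1 G2).
Local Notation matching := {ffun vertex G1 * vertex G2 -> bool}.
Implicit Types (lam : {set op}) (y : matching).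

(** Stated for any commutative monoid, to serve both for counting operations and for summing
    costs. *)
Lemma big_edit_op (M : Type) (idx : M) (add : Monoid.com_law idx) (F : op -> M) :
  \big[add/idx]_o F o =
    add (add (add (\big[add/idx]_i \big[add/idx]_k F (VSubst i k))
                  (\big[add/idx]_i F (VDel i)))
             (\big[add/idx]_k F (VIns k)))
        (add (add (\big[add/idx]_e1 \big[add/idx]_e2 F (ESubst e1 e2))
                  (\big[add/idx]_e1 F (EDel e1)))
             (\big[add/idx]_e2 F (EIns e2))).
Proof.
rewrite (reindex (@edit_op_decode G1 G2)) /=; last first.
  exists (@edit_op_code G1 G2) => [x _|o _]; last exact: edit_op_codeK.
  by case: x => [[[[]|]|]|[[[]|]|]].
rewrite !big_sumType /= !pair_bigA /=.
by congr (add (add (add _ _) _) (add (add _ _) _)); apply: eq_bigr => -[].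
Qed.

Lemma card_ops lam (p : pred op) :
  #|[set o in lam | p o]| = (\sum_o ((o \in lam) && p o))%N.
Proof.
rewrite -sum1_card [LHS]big_mkcond; apply: eq_bigr => o _.
by rewrite inE; case: (_ && _).
Qed.

Lemma sum_at (T : finType) (P : pred T) (a : T) :
  (\sum_x (P x && (x == a)) = P a)%N.
Proof.
rewrite (bigD1 a) //= eqxx andbT big1 ?addn0 // => x /negbTE ->.
by rewrite andbF.
Qed.

Lemma sum2_at (T U : finType) (P : T -> U -> bool) (a : T) :
  (\sum_x \sum_z (P x z && (x == a)) = \sum_z P a z)%N.
Proof. by rewrite exchange_big; apply: eq_bigr => z _; rewrite sum_at. Qed.

Let big0F (T : finType) (P : pred T) : (\sum_x (P x && false) = 0)%N.
Proof. by rewrite big1 // => x _; rewrite andbF. Qed.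

Let big00F (T U : finType) (P : T -> U -> bool) :
  (\sum_x \sum_z (P x z && false) = 0)%N.
Proof. by rewrite big1. Qed.

(** Only two of the six kinds of operation can act on [u]. This and its three analogues make the
    cardinality conditions linear. *)
Lemma card_src_vertex lam u :
  #|[set o in lam | on_src_vertex u o]|
  = ((VDel u \in lam) + \sum_k (VSubst u k \in lam))%N.
Proof.
rewrite card_ops big_edit_op /=.
by rewrite sum2_at sum_at !big0F !big00F !addn0 addnC.
Qed.

Lemma card_tgt_vertex lam v :
  #|[set o in lam | on_tgt_vertex v o]|
  = ((VIns v \in lam) + \sum_i (VSubst i v \in lam))%N.
Proof.
(* The swap makes the index pinned to [v] the outer one, as [sum2_at] expects. *)
rewrite card_ops big_edit_op /= exchange_big.
by rewrite sum2_at sum_at !big0F !big00F !addn0 addnC.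
Qed.

Lemma card_src_edge lam e :
  #|[set o in lam | on_src_edge e o]|
  = ((EDel e \in lam) + \sum_e2 (ESubst e e2 \in lam))%N.
Proof.
rewrite card_ops big_edit_op /=.
by rewrite sum2_at sum_at !big0F !big00F !addn0 !add0n addnC.
Qed.

Lemma card_tgt_edge lam e :
  #|[set o in lam | on_tgt_edge e o]|
  = ((EIns e \in lam) + \sum_e1 (ESubst e1 e \in lam))%N.
Proof.
rewrite card_ops big_edit_op /= [X in (_ + (X + _ + _))%N]exchange_big.
by rewrite sum2_at sum_at !big0F !big00F !addn0 !add0n addnC.
Qed.

Definition matching_of lam : matching := [ffun p => VSubst p.1 p.2 \in lam].

Lemma matching_of_induced y : matching_of (induced_edit_path y) = y.
Proof. by apply/ffunP => -[i k]; rewrite ffunE inE. Qed.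

Lemma matching_of_assignment lam :
  is_edit_path lam -> is_assignment (matching_of lam).
Proof.
move=> h; split=> [k|i]; under eq_bigr do rewrite ffunE.
  by rewrite -(ep_tgt_vertex h k) card_tgt_vertex leq_addl.
by rewrite -(ep_src_vertex h i) card_src_vertex leq_addl.
Qed.

(** An assignment is a partial injection in both directions, so the images of its ends determine the
    image of an edge. *)
Lemma induced_edit_path_is_edit_path y :
  is_assignment y -> is_edit_path (induced_edit_path y).
Proof.
case=> col row.
have inj1 i k l : y (i, k) -> y (i, l) -> k = l.
  by move/sum_pred_le1P: (row i); apply.
have inj2 i j k : y (i, k) -> y (j, k) -> i = j.
  by move/sum_pred_le1P: (col k); apply.
split.
- move=> u; rewrite card_src_vertex inE.
  by under [X in (_ + X)%N]eq_bigr do rewrite inE; apply: exactly_one.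
- move=> v; rewrite card_tgt_vertex inE.
  by under [X in (_ + X)%N]eq_bigr do rewrite inE; apply: exactly_one.
- move=> e; rewrite card_src_edge inE -sum_pred_eq0.
  under [X in (_ + X)%N]eq_bigr do rewrite inE.
  (* Two images of [e] share their tail and their head, and an edge is the pair of its ends. *)
  apply/exactly_one/sum_pred_le1P => e2 e2' /andP[t h] /andP[t' h'].
  apply/val_inj/eqP; rewrite -pair_eqE /=; apply/andP.
  by split; apply/eqP; [apply: inj1 t t'|apply: inj1 h h'].
- move=> e; rewrite card_tgt_edge inE -sum_pred_eq0.
  under [X in (_ + X)%N]eq_bigr do rewrite inE.
  apply/exactly_one/sum_pred_le1P => e1 e1' /andP[t h] /andP[t' h'].
  apply/val_inj/eqP; rewrite -pair_eqE /=; apply/andP.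
  by split; apply/eqP; [apply: inj2 t t'|apply: inj2 h h'].
- move=> u e; rewrite !inE sum_pred_eq0 negb_exists => /forallP yu0 inc.
  apply/existsPn => e2; apply/negP => /andP[t h].
  case: inc => eu; rewrite eu in t h;
    [move: (yu0 (etail e2))|move: (yu0 (ehead e2))].
    by rewrite t.
  by rewrite h.
- move=> v e _ _; rewrite inE sum_pred_eq0.
  have [/existsP[u yuv]|_] := boolP [exists i, y (i, v)]; last by right.
  by left; exists u; rewrite inE.
- by move=> e1 e2; rewrite !inE; split => /andP.
- move=> e k l; rewrite !inE => yk yl /negP kl; apply/existsPn => e2.
  apply/negP => /andP[t h]; apply: kl.
  (* A substitute [e2] would have ends [k] and [l], making [(k, l)] an edge. *)
  rewrite (inj1 _ _ _ yk t) (inj1 _ _ _ yl h) /etail /ehead -surjective_pairing.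
  exact: valP.
- move=> i j e; rewrite !inE => yi yj /negP ij; apply/existsPn => e1.
  apply/negP => /andP[t h]; apply: ij.
  rewrite (inj2 _ _ _ yi t) (inj2 _ _ _ yj h) /etail /ehead -surjective_pairing.
  exact: valP.
Qed.

Variables (R : realType) (c : op -> R).

Lemma sum_unmatched (T U : finType) (a : T -> R) (d : T -> bool)
    (s : T -> U -> bool) :
  (forall x, d x + \sum_z s x z = 1)%N ->
  \sum_x a x * (d x)%:R = \sum_x a x - \sum_x \sum_z a x * (s x z)%:R.
Proof.
move=> H; rewrite -sumrB; apply: eq_bigr => x _.
rewrite -mulr_sumr -natr_sum -[X in X - _]mulr1 -mulrBr; congr (_ * _).
by apply: (canRL (addrK _)); rewrite -natrD H.
Qed.

(** Holding for every edit path, this handles an arbitrary competitor without first showing that it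
    is induced by an assignment. *)
Lemma edit_cost_gm_score lam : is_edit_path lam ->
  edit_cost c lam =
    \sum_i c (VDel i) + \sum_k c (VIns k)
    + (\sum_e1 c (EDel e1) + \sum_e2 c (EIns e2))
    - gm_score (similarity_of_cost c) (matching_of lam).
Proof.
move=> h.
have -> : edit_cost c lam = \sum_o c o * (o \in lam)%:R.
  rewrite /edit_cost big_mkcond; apply: eq_bigr => o _.
  by case: (_ \in _); rewrite ?mulr1 ?mulr0.
rewrite big_edit_op /=.
rewrite (@sum_unmatched _ _ (fun i => c (VDel i)) _
  (fun i k => VSubst i k \in lam)); last first.
  by move=> u; rewrite -card_src_vertex (ep_src_vertex h).
rewrite (@sum_unmatched _ _ (fun k => c (VIns k)) _
  (fun k i => VSubst i k \in lam)); last first.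
  by move=> u; rewrite -card_tgt_vertex (ep_tgt_vertex h).
rewrite (@sum_unmatched _ _ (fun e => c (EDel e)) _
  (fun e f => ESubst e f \in lam)); last first.
  by move=> u; rewrite -card_src_edge (ep_src_edge h).
rewrite (@sum_unmatched _ _ (fun e => c (EIns e)) _
  (fun e f => ESubst f e \in lam)); last first.
  by move=> u; rewrite -card_tgt_edge (ep_tgt_edge h).
(* The insertion terms are reindexed source first, the order used in the score. *)
rewrite [X in _ + (_ - X) + _]exchange_big
  [X in _ + (_ + (_ - X))]exchange_big /=.
have score3 (T U : finType) (f g k : T -> U -> R) (m : T -> U -> bool) :
    \sum_i \sum_j - (f i j - g i j - k i j) * (m i j)%:R =
    \sum_i \sum_j g i j * (m i j)%:R + \sum_i \sum_j k i j * (m i j)%:R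
    - \sum_i \sum_j f i j * (m i j)%:R.
  rewrite -big_split -sumrB; apply: eq_bigr => i _ /=.
  by rewrite -big_split -sumrB; apply: eq_bigr => j _ /=; ring.
rewrite /gm_score /=; under [X in _ - (X + _)]eq_bigr do
  under eq_bigr do rewrite ffunE.
(* [ep_edge_substitution] linearizes the quadratic part of the score: the product of the two
   endpoint indicators is the indicator of the edge substitution. *)
have -> : \sum_(e1 : edge G1) \sum_(e2 : edge G2)
    - (c (ESubst e1 e2) - c (EDel e1) - c (EIns e2))
      * (matching_of lam (etail e1, etail e2))%:R
      * (matching_of lam (ehead e1, ehead e2))%:R =
  \sum_(e1 : edge G1) \sum_(e2 : edge G2)
    - (c (ESubst e1 e2) - c (EDel e1) - c (EIns e2)) * (ESubst e1 e2 \in lam)%:R.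
  apply: eq_bigr => e1 _; apply: eq_bigr => e2 _.
  rewrite !ffunE -mulrA -natrM mulnb; congr (_ * (nat_of_bool _)%:R).
  by apply/andP/idP => /(ep_edge_substitution h).
by rewrite !score3; ring.
Qed.

End EditPaths.

Theorem proposition1 (R : realType) (G1 G2 : attributed_graph)
    (c : edit_op G1 G2 -> R) (y : {ffun vertex G1 * vertex G2 -> bool})
    (hy : is_assignment y) :
  gm_optimal (similarity_of_cost c) y <-> ged_optimal c (induced_edit_path y).
Proof.
have hl := induced_edit_path_is_edit_path hy.
split=> -[_ opt]; split=> //.
  move=> lam hlam; rewrite !edit_cost_gm_score // matching_of_induced.
  (* The competitor [lam] is compared through the assignment formed by its vertex substitutions. *)
  by rewrite lerD2l lerN2; apply/opt/matching_of_assignment.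
move=> z hz; have hlz := induced_edit_path_is_edit_path hz.
by move: (opt _ hlz); rewrite !edit_cost_gm_score // !matching_of_induced
  lerD2l lerN2.
Qed.
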